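(* For every integer $n\ge1$, the signed binomial-Eulerian polynomial $\tilde A_n(t,-1)=\sum_{i=0}^n h_it^i$ (the specialization at $q=-1$ of the $q$-binomial-Eulerian polynomial $\tilde A_n(t,q)$) is palindromic and unimodal.
   Context: Let $\mathfrak S_n$ be the set of permutations of $[n]=\{1,\dots,n\}$. For $\pi=\pi_1\cdots\pi_n\in\mathfrak S_n$ let $\mathrm{exc}(\pi)=|\{i\in[n-1]:\pi_i>i\}|$ and $\mathrm{maj}(\pi)=\sum_{i\in[n-1],\,\pi_i>\pi_{i+1}} i$. For $n\ge1$ let $$A_n(t,q)=\sum_{\pi\in\mathfrak S_n}t^{\mathrm{exc}(\pi)}q^{\mathrm{maj}(\pi)-\mathrm{exc}(\pi)},\qquad \tilde A_n(t,q)=1+t\sum_{m=1}^n{n\brack m}_qA_m(t,q),$$ where ${n\brack m}_q=\frac{(q;q)_n}{(q;q)_m(q;q)_{n-m}}$, $(q;q)_n=\prod_{i=1}^n(1-q^i)$, is the $q$-binomial coefficient (a polynomial in $q$, which can be evaluated at $q=-1$). The polynomial $\tilde A_n(t,q)$ has degree $n$ in $t$. A polynomial $\sum_{i=0}^nh_it^i$ with real coefficients is palindromic if $h_i=h_{n-i}$ for all $0\le i\le\lfloor n/2\rfloor$, and unimodal if $h_0\le h_1\le\cdots\le h_c\ge h_{c+1}\ge\cdots\ge h_n$ for some $c$. *)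

(* Defs.v *)
From HB Require Import structures.
From mathcomp Require Import all_boot all_order all_fingroup all_algebra.
Set Implicit Arguments.
Unset Strict Implicit.
Unset Printing Implicit Defensive.
Import Order.TTheory GRing.Theory Num.Theory.
Local Open Scope ring_scope.

(* 'I_n = {0, ..., n-1}, so i : 'I_n stands for the position i.+1 of [n].
   The position n is never an excedance. *)
Definition exc n (s : 'S_n) : nat := #|[set i : 'I_n | (i < s i)%N]|.

(* The inner sum has at most one term: j is the position following i. *)
Definition maj n (s : 'S_n) : nat :=
  (\sum_(i < n) \sum_(j < n | (j == i.+1 :> nat) && (s j < s i)) i.+1)%N.

(* After the last descent d the word increases up to a value at most n, so
   there is no excedance there: exc <= d <= maj. *)
Lemma exc_le_maj n (s : 'S_n) : (exc s <= maj s)%N.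
Proof.
suff H (i : 'I_n) : (i < s i)%N -> (i < maj s)%N.
  have Hle : (#|[set i : 'I_n | (i < s i)%N]| <= #|[set: 'I_(maj s)]|)%N.
    case E: (maj s) => [|d].
      rewrite (_ : [set i : 'I_n | _] = set0) ?cards0 //.
      by apply/setP => i; rewrite !inE; apply/negP => /H; rewrite E.
    rewrite -(card_in_imset (f := fun i : 'I_n => inord i : 'I_d.+1)).
      by apply: subset_leq_card; apply: subsetT.
    move=> i j; rewrite !inE => /H Hi /H Hj /(congr1 (@nat_of_ord _)).
    by rewrite !inordK -?E // => /val_inj.
  by rewrite cardsT card_ord in Hle.
have [k] := ubnP (n - i); elim: k i => // k IHk i; rewrite ltnS => Hk Hi.
have lt_n : (i.+1 < n)%N by apply: leq_ltn_trans Hi (ltn_ord _).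
pose j := Ordinal lt_n.
case: (ltngtP (s j) (s i)) => [lt_ji|lt_ij|/val_inj/perm_inj /(congr1 val) /= E].
- rewrite /maj (bigD1 i) //= (bigD1 j) /=; last by rewrite eqxx.
  by rewrite -addnA leq_addr.
- have: (j < maj s)%N.
    apply: IHk => /=; last by apply: leq_ltn_trans lt_ij.
    by apply: leq_trans Hk; rewrite ltn_sub2l // ltnW.
  exact: ltnW.
- by move: (ltnn i); rewrite -{2}E ltnSn.
Qed.

Definition qpochhammer (R : fieldType) (n : nat) : {poly R} :=
  \prod_(1 <= i < n.+1) (1 - 'X^i).

Definition qbinomial (R : fieldType) (n m : nat) : {poly R} :=
  qpochhammer R n %/ (qpochhammer R m * qpochhammer R (n - m)).

Lemma qbinomialE (R : fieldType) (n m : nat) : (m <= n)%N ->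
  qpochhammer R n =
  qbinomial R n m * (qpochhammer R m * qpochhammer R (n - m)).
Proof.
move=> le_mn; rewrite /qbinomial divpK //.
suff H k l : qpochhammer R k * qpochhammer R l %| qpochhammer R (k + l)%N.
  by have := H m (n - m)%N; rewrite subnKC.
have S a : qpochhammer R a.+1 = qpochhammer R a * (1 - 'X^(a.+1)).
  by rewrite /qpochhammer big_nat_recr.
have P0 : qpochhammer R 0 = 1 by rewrite /qpochhammer big_geq.
have [N] := ubnP (k + l); elim: N k l => // N IH [|k] [|l];
  rewrite ?P0 ?mul1r ?mulr1 ?addn0 ?add0n // ltnS => HN.
have E : 1 - 'X^((k + l.+1).+1) =
    (1 - 'X^(k.+1)) + 'X^(k.+1) * (1 - 'X^(l.+1)) :> {poly R}.
  by rewrite mulrBr mulr1 -exprD addrA subrK addSn.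
rewrite [(k.+1 + _)%N]addSn [qpochhammer R _.+1 in X in _ %| X]S E mulrDr.
rewrite dvdp_add //.
- by rewrite S mulrAC dvdp_mul // IH.
- rewrite mulrCA dvdp_mull // (S l) mulrA dvdp_mul // addnS -addSn IH //.
  by rewrite addnS -addSn in HN.
Qed.

(* In {poly {poly R}} the outer variable is t and the inner one is q. *)
Definition Eulerian (R : fieldType) (n : nat) : {poly {poly R}} :=
  \sum_(s : 'S_n) 'X^(maj s - exc s) *: 'X^(exc s).

Definition binomialEulerian (R : fieldType) (n : nat) : {poly {poly R}} :=
  1 + 'X * \sum_(1 <= m < n.+1) qbinomial R n m *: Eulerian R m.

Definition signedBinomialEulerian (R : fieldType) (n : nat) : {poly R} :=
  map_poly (horner_eval (-1)) (binomialEulerian R n).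

(* Both properties are relative to writing p as \sum_(i <= n) p`_i t^i,
   whence the bound on the size of p. *)
Definition palindromic (R : realFieldType) (n : nat) (p : {poly R}) : Prop :=
  (size p <= n.+1)%N /\ forall i : nat, (i <= n./2)%N -> p`_i = p`_(n - i).

Definition unimodal (R : realFieldType) (n : nat) (p : {poly R}) : Prop :=
  (size p <= n.+1)%N /\
  exists2 c : nat, (c <= n)%N &
    (forall i : nat, (i < c)%N -> p`_i <= p`_i.+1) /\
    (forall i : nat, (c <= i < n)%N -> p`_i.+1 <= p`_i).

(* Main.v *)
(* At q = -1 the sign (-1)^maj is the product over i of the signs of the pairs
   (pi_{2i-1}, pi_{2i}).  Exchanging the two entries of a pair reverses the sign
   and keeps exc, unless the value 2i is one of them, in which case moving
   2i from position 2i to 2i-1 multiplies the weight by t.  So each pair contributes a factor 1 + t and one is left with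
   permutations fixing the even points, that is
     A_n(t, -1) = (1 + t)^(n/2) A_(n - n/2)(t),
   where n/2 is rounded down and A_k is the Eulerian polynomial.  The q-binomial
   coefficients become binomial coefficients or 0.  Writing E for the exponential
   generating function of (1 + t)^k A_k(t) and T for that of the even-indexed
   polynomials, one finds T' = T (1 + t (1 + t) E), and T (1 + t E) for the
   odd-indexed ones.  Once the constant term 1 of E is isolated, both are
   recurrences among products of palindromic unimodal polynomials with
   nonnegative coefficients, with the same centre of symmetry throughout. *)

Require Import Defs.
From mathcomp Require Import all_boot all_order all_fingroup all_algebra.
From mathcomp Require Import zify ring.
Set Implicit Arguments.
Unset Strict Implicit.
Unset Printing Implicit Defensive.
Import Order.TTheory GRing.Theory Num.Theory.
Local Open Scope ring_scope.

(** * Binomial convolution: products of exponential generating functions *)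

Section BinomialConvolution.

Variable V : comNzRingType.
Implicit Types f g h : nat -> V.

Definition bconv f g n : V := \sum_(i < n.+1) (f i * g (n - i)%N) *+ 'C(n, i).

Lemma eq_bconv f f' g g' n : (forall i, f i = f' i) -> (forall i, g i = g' i) ->
  bconv f g n = bconv f' g' n.
Proof. by move=> eqf eqg; apply: eq_bigr => i _; rewrite eqf eqg. Qed.

Lemma bconvC f g n : bconv f g n = bconv g f n.
Proof.
rewrite /bconv (reindex_inj rev_ord_inj); apply: eq_bigr => i _ /=.
by rewrite subSS subKn ?bin_sub ?[f _ * _]mulrC // -ltnS.
Qed.

Lemma bconvDr f g h n : bconv f (fun i => g i + h i) n = bconv f g n + bconv f h n.
Proof. by rewrite -big_split; apply: eq_bigr => i _; rewrite mulrDr mulrnDl. Qed.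

Lemma bconvDl f g h n : bconv (fun i => f i + g i) h n = bconv f h n + bconv g h n.
Proof. by rewrite !(bconvC _ h) bconvDr. Qed.

Lemma bconvZr c f g n : bconv f (fun i => c * g i) n = c * bconv f g n.
Proof. by rewrite mulr_sumr; apply: eq_bigr => i _; rewrite mulrCA mulrnAr. Qed.

Lemma bconvZl c f g n : bconv (fun i => c * f i) g n = c * bconv f g n.
Proof. by rewrite !(bconvC _ g) bconvZr. Qed.

Lemma bconv_const f c n : bconv f (fun=> c) n = c * bconv (fun=> 1) f n.
Proof. by rewrite bconvC -bconvZl; apply: eq_bconv => // i; rewrite mulr1. Qed.

(** Leibniz rule: shifting a sequence differentiates its exponential generating function. *)
Lemma bconvS f g n :
  bconv f g n.+1 = bconv (fun i => f i.+1) g n + bconv f (fun i => g i.+1) n.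
Proof.
rewrite /bconv big_ord_recl /= bin0 subn0.
under eq_bigr => i _ do rewrite /bump leq0n add1n subSS binS mulrnDr.
rewrite big_split /= addrA [LHS]addrC; congr (_ + _).
rewrite big_ord_recr /= bin_small // mulr0n addr0 [RHS]big_ord_recl /= bin0 subn0.
congr (_ + _); apply: eq_bigr => i _.
by rewrite /bump leq0n add1n subnSK.
Qed.

(** Both sides have the same constant term and, by the Leibniz rule, derivatives of the same form,
    so induction on [n] applies. *)
Lemma bconvA f g h n : bconv f (bconv g h) n = bconv (bconv f g) h n.
Proof.
elim: n f g h => [|n IH] f g h.
  by rewrite /bconv !big_ord1 /= !bin0 !mulr1n mulrA.
rewrite !bconvS (eq_bconv _ (fun=> erefl) (bconvS g h)) bconvDr.
by rewrite (eq_bconv _ (bconvS f g) (fun=> erefl)) bconvDl !IH addrA.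
Qed.

Lemma bconv_recr f g n :
  bconv f g n = f n * g 0 + \sum_(i < n) (f i * g (n - i)%N) *+ 'C(n, i).
Proof. by rewrite /bconv big_ord_recr /= subnn binn mulr1n addrC. Qed.

End BinomialConvolution.

(** * Eulerian polynomials: insertion recurrence and quadratic recurrence *)

Section EulerianRecurrence.

Variable R : comNzRingType.

(* The Eulerian polynomials, by insertion of a new maximum. *)
Fixpoint eul (n : nat) : {poly R} :=
  if n is k.+1 then (1 + 'X *+ k) * eul k + 'X * (1 - 'X) * (eul k)^`() else 1.

Lemma eulS n :
  eul n.+1 = (1 + 'X *+ n) * eul n + 'X * (1 - 'X) * (eul n)^`().
Proof. by []. Qed.

Lemma eul0 : eul 0 = 1.
Proof. by []. Qed.

(** Each factor contributes its own insertion recurrence; the derivatives combine by the product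
    rule and the multiples of ['X] add up to ['X *+ n]. *)
Lemma bconv_eulS n : bconv eul eul n.+1 =
  (2 + 'X *+ n) * bconv eul eul n + 'X * (1 - 'X) * (bconv eul eul n)^`().
Proof.
rewrite bconvS /bconv raddf_sum -big_split !mulr_sumr -big_split.
apply: eq_bigr => i _ /=; rewrite derivMn derivM.
have -> : 'X *+ n = 'X *+ i + 'X *+ (n - i) :> {poly R}.
  by rewrite -mulrnDr subnKC // -ltnS.
move: 'C(n, i) (n - i)%N (i : nat) => b k j; ring.
Qed.

(* This is the differential equation E' = E (1 - t + t E) of the exponential
   generating function E. *)
Lemma eul_quadratic n :
  eul n.+1 = (1 - 'X) * eul n + 'X * bconv eul eul n.
Proof.
elim: n => [|n IH].
  by rewrite /bconv big_ord1 /= bin0 derivC mulr1n; ring.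
rewrite eulS {1 2}IH bconv_eulS.
rewrite derivD !derivM derivB derivX derivC eulS; ring.
Qed.

End EulerianRecurrence.

Arguments eul R n : simpl never.

(** * The cone of palindromic unimodal polynomials with a fixed centre *)

Section SymmetricUnimodalCone.

Variable R : realFieldType.
Implicit Types p q : {poly R}.

Definition geom m : {poly R} := \sum_(i < m) 'X^i.

Lemma geomE m : (1 - 'X) * geom m = 1 - 'X^m.
Proof. by rewrite -[1 - 'X^m]opprB subrX1 -mulNr opprB. Qed.

Lemma coef_geom m i : (geom m)`_i = (i < m)%:R.
Proof.
have -> : geom m = \poly_(j < m) 1.
  by rewrite poly_def; apply: eq_bigr => j _; rewrite scale1r.
by rewrite coef_poly; case: ltnP.
Qed.

(* Clebsch-Gordan, one step at a time. *)
Lemma geomM m l : geom m.+1 * geom l.+1 = 'X * (geom m * geom l) + geom (m + l).+1.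
Proof.
have nz : (1 - 'X) * (1 - 'X) != 0 :> {poly R}.
  by rewrite mulf_neq0 // -(opprB 'X) oppr_eq0 polyXsubC_eq0.
apply: (mulfI nz).
transitivity ((1 - 'X^(m.+1)) * (1 - 'X^(l.+1)) : {poly R}).
  rewrite -(geomE m.+1) -(geomE l.+1).
  by move: 'X (geom m.+1) (geom l.+1) => t a b; ring.
transitivity ('X * ((1 - 'X^m) * (1 - 'X^l)) + (1 - 'X) * (1 - 'X^((m + l).+1)) : {poly R}).
  by rewrite !exprS exprD; move: 'X ('X^m) ('X^l) => t a b; ring.
rewrite -(geomE m) -(geomE l) -(geomE (m + l).+1).
by move: 'X (geom m) (geom l) (geom _) => t a b c; ring.
Qed.

(* The palindromic unimodal polynomials with centre d/2 and nonnegative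
   coefficients. *)
Inductive symcone : nat -> {poly R} -> Prop :=
| symcone0 d : symcone d 0
| symconeD d p q : symcone d p -> symcone d q -> symcone d (p + q)
| symcone_geom c a m : 0 <= c -> symcone (a.*2 + m) (c *: ('X^a * geom m.+1)).

Lemma symcone_sum d (I : Type) (r : seq I) (P : pred I) (F : I -> {poly R}) :
  (forall i, P i -> symcone d (F i)) -> symcone d (\sum_(i <- r | P i) F i).
Proof. by move=> H; apply: big_ind => //; [apply: symcone0 | apply: symconeD]. Qed.

Lemma symconeMn d p k : symcone d p -> symcone d (p *+ k).
Proof.
move=> Hp; elim: k => [|k IH]; first exact: symcone0.
by rewrite mulrS; apply: symconeD.
Qed.

Lemma symcone_scaleX d c a p : 0 <= c -> symcone d p ->
  symcone (a.*2 + d) (c *: ('X^a * p)).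
Proof.
move=> c0; elim=> {d p} [d|d p q _ IHp _ IHq|b e m b0].
- by rewrite mulr0 scaler0; apply: symcone0.
- by rewrite mulrDr scalerDr; apply: symconeD.
- rewrite -scalerAr scalerA mulrA -exprD addnA -doubleD.
  by apply: symcone_geom; apply: mulr_ge0.
Qed.

(** Iterating [geomM] splits the product into pieces ['X^a * geom _] that all have centre (m +
    l)/2. *)
Lemma symcone_geomM m l : symcone (m + l) (geom m.+1 * geom l.+1).
Proof.
elim: m l => [|m IH] [|l]; last 1 first.
- rewrite geomM; apply: symconeD.
    have := symcone_scaleX 1 ler01 (IH l).
    by rewrite scale1r expr1 addSn addnS.
  have := symcone_geom 0 (m.+1 + l.+1) ler01.
  by rewrite scale1r expr0 mul1r.
all: rewrite geomM /geom big_ord0 ?mulr0 ?mul0r ?mulr0 add0r.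
- by have := symcone_geom 0 0 ler01; rewrite scale1r expr0 mul1r.
- by have := symcone_geom 0 (0 + l.+1) ler01; rewrite scale1r expr0 mul1r.
- by have := symcone_geom 0 (m.+1 + 0) ler01; rewrite scale1r expr0 mul1r.
Qed.

Lemma symconeM d e p q : symcone d p -> symcone e q -> symcone (d + e) (p * q).
Proof.
move=> Hp; elim=> {e q} [e|e q r _ IHq _ IHr|b f l b0].
- by rewrite mulr0; apply: symcone0.
- by rewrite mulrDr; apply: symconeD.
elim: Hp => {d p} [d|d p q _ IHp _ IHq|c a m c0].
- by rewrite mul0r; apply: symcone0.
- by rewrite mulrDl; apply: symconeD.
have -> : c *: ('X^a * geom m.+1) * (b *: ('X^f * geom l.+1)) =
    (c * b) *: ('X^(a + f) * (geom m.+1 * geom l.+1)).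
  by rewrite -scalerAl -scalerAr scalerA exprD; congr (_ *: _); ring.
rewrite addnACA -doubleD.
by apply: symcone_scaleX; [apply: mulr_ge0 | apply: symcone_geomM].
Qed.

Lemma symcone1 : symcone 0 1.
Proof.
by have := symcone_geom 0 0 ler01; rewrite scale1r /geom big_ord1 mul1r.
Qed.

Lemma symcone_X : symcone 2 'X.
Proof. by have := symcone_scaleX 1 ler01 symcone1; rewrite scale1r mulr1. Qed.

Lemma symcone_1DX : symcone 1 (1 + 'X).
Proof.
by have := symcone_geom 0 1 ler01; rewrite scale1r mul1r /geom !big_ord_recl big_ord0 addr0.
Qed.

Lemma symcone_1DX_exp k : symcone k ((1 + 'X) ^+ k).
Proof.
elim: k => [|k IH]; first exact: symcone1.
by rewrite exprS; apply: (symconeM symcone_1DX IH).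
Qed.

Lemma symcone_1DXDX2 : symcone 2 (1 + 'X + 'X^2).
Proof.
have := symcone_geom 0 2 ler01.
by rewrite scale1r mul1r /geom !big_ord_recl big_ord0 addr0 addrA.
Qed.

Lemma symcone_palindromic d p : symcone d p -> palindromic d p.
Proof.
elim=> {d p} [d|d p q _ [sp ep] _ [sq eq_q]|c a m c0].
- by split=> [|i _]; rewrite ?size_poly0 // !coef0.
- split=> [|i le_i]; last by rewrite !coefD (ep i) ?(eq_q i).
  by apply: leq_trans (size_polyD _ _) _; rewrite geq_max sp.
- split=> [|i le_i].
    apply/leq_sizeP => j le_j.
    rewrite coefZ coefXnM coef_geom; case: ifP => [_|lt_j]; rewrite ?mulr0 //.
    by rewrite (_ : (_ < _)%N = false) ?mulr0 //; lia.
  rewrite !coefZ !coefXnM !coef_geom; congr (_ * _).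
  case: (ltnP i a) => ?; case: (ltnP (a.*2 + m - i)%N a) => ? //.
  - by case: ltnP => //; lia.
  - by case: ltnP => //; lia.
  - by congr ((nat_of_bool _)%:R); lia.
Qed.

(** The peak sits at [d./2] for every member, so the inequalities survive addition; with unspecified
    peaks they would not. *)
Lemma symcone_incr d p i : symcone d p -> (i < d./2)%N -> p`_i <= p`_i.+1.
Proof.
move=> Hp; elim: Hp i => {d p} [d|d p q _ IHp _ IHq|c a m c0] i lt_i.
- by rewrite !coef0.
- by rewrite !coefD lerD ?IHp ?IHq.
rewrite !coefZ !coefXnM !coef_geom ler_wpM2l //.
case: ifP => ?; first by case: ifP.
case: ifP => ?; first lia.
by rewrite ler_nat; do 2!case: ltnP => ?; lia.
Qed.

Lemma symcone_decr d p i : symcone d p -> (d./2 <= i < d)%N -> p`_i.+1 <= p`_i.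
Proof.
move=> Hp; elim: Hp i => {d p} [d|d p q _ IHp _ IHq|c a m c0] i lt_i.
- by rewrite !coef0.
- by rewrite !coefD lerD ?IHp ?IHq.
rewrite !coefZ !coefXnM !coef_geom ler_wpM2l //.
do 2!case: ifP => ?; rewrite ?ler_nat //; lia.
Qed.

Lemma symcone_unimodal d p : symcone d p -> unimodal d p.
Proof.
move=> Hp; have [sp _] := symcone_palindromic Hp; split=> //.
exists d./2; first by lia.
by split=> i; [apply: symcone_incr | apply: symcone_decr].
Qed.

End SymmetricUnimodalCone.

(** * The q-binomial coefficients at q = -1 *)

Section QBinomial.

Variable R : fieldType.

Local Notation P := (qpochhammer R).

Lemma qpochhammerS n : P n.+1 = P n * (1 - 'X^(n.+1)).
Proof. by rewrite /qpochhammer big_nat_recr. Qed.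

Lemma qpochhammer_neq0 n : P n != 0.
Proof.
elim: n => [|n IH]; first by rewrite /qpochhammer big_geq ?oner_eq0.
by rewrite qpochhammerS mulf_neq0 // -opprB oppr_eq0 -size_poly_eq0 size_XnsubC.
Qed.

Lemma qpochhammer0 : P 0 = 1.
Proof. by rewrite /qpochhammer big_geq. Qed.

Lemma qbinomial0 n : qbinomial R n 0 = 1.
Proof.
by rewrite /qbinomial subn0 qpochhammer0 mul1r divpp ?qpochhammer_neq0.
Qed.

Lemma qbinomialnn n : qbinomial R n n = 1.
Proof.
by rewrite /qbinomial subnn qpochhammer0 mulr1 divpp ?qpochhammer_neq0.
Qed.

(** The q-Pascal rule, checked after clearing the common denominator. *)
Lemma qbinomialS n m : (m < n)%N ->
  qbinomial R n.+1 m.+1 = qbinomial R n m + 'X^(m.+1) * qbinomial R n m.+1.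
Proof.
move=> lt_mn.
have nz : P m.+1 * P (n - m) != 0 by rewrite mulf_neq0 ?qpochhammer_neq0.
apply: (mulIf nz).
have := qbinomialE R (ltnW lt_mn : (m.+1 <= n.+1)%N); rewrite subSS => <-.
have E1 := qbinomialE R (ltnW lt_mn).
have E2 := qbinomialE R lt_mn.
have X : 'X^(n.+1) = 'X^(m.+1) * 'X^(n - m) :> {poly R}.
  by rewrite -exprD addSn subnKC // ltnW.
have S : P (n - m) = P (n - m.+1) * (1 - 'X^(n - m)).
  by rewrite -(subnSK lt_mn) qpochhammerS.
have -> : P n.+1 = (1 - 'X^(m.+1)) * P n + 'X^(m.+1) * (1 - 'X^(n - m)) * P n.
  by rewrite qpochhammerS X; ring.
by rewrite {1}E1 E2 S qpochhammerS; ring.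
Qed.

(** The case q = -1 of the q-Lucas theorem, by the q-Pascal rule in the four parity cases. *)
Lemma qbinomial_eval_neg1 n m : (m <= n)%N -> (qbinomial R n m).[-1] =
  if odd m && ~~ odd n then 0 else 'C(n./2, m./2)%:R.
Proof.
elim: n m => [|n IH] [|m] //; rewrite ?qbinomial0 ?hornerC ?bin0 //.
rewrite ltnS leq_eqVlt => /orP[/eqP-> {m}|lt_mn].
  by rewrite qbinomialnn hornerC binn /=; case: odd.
rewrite qbinomialS // hornerD hornerM hornerXn !IH ?(ltnW lt_mn) //.
rewrite exprS -signr_odd /= !negbK !uphalf_half.
case: (odd m); case: (odd n) => /=; rewrite ?add0n ?add1n ?binS ?natrD; ring.
Qed.

End QBinomial.

(** * Excedances of permutations supported on a subset *)

Section PermStatistics.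

Variable n : nat.
Implicit Types (s : 'S_n) (i j x y m : 'I_n) (D : {set 'I_n}).

Lemma excE s : exc s = (\sum_(i < n) (i < s i))%N.
Proof.
rewrite /exc -sum1_card big_mkcond /=; apply: eq_bigr => i _.
by rewrite inE; case: ltnP.
Qed.

Lemma perm_on_setD1 D m s : m \in D ->
  perm_on (D :\ m) s = perm_on D s && (s m == m).
Proof.
move=> mD; apply/idP/andP => [Hs|[/subsetP Hs /eqP sm]].
  split; first by apply: subset_trans Hs (subD1set _ _).
  by apply/eqP; apply: (out_perm Hs); rewrite !inE eqxx.
apply/subsetP => x; rewrite !inE => sx.
rewrite (Hs x) ?inE // andbT; apply: contraNneq sx => ->.
by rewrite sm.
Qed.

Lemma perm_on_tpermM D x y s : x \in D -> y \in D ->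
  perm_on D (tperm x y * s)%g = perm_on D s.
Proof.
move=> xD yD; have Ht : perm_on D (tperm x y).
  apply/subsetP => z; rewrite inE; apply: contraR => zD.
  by rewrite tpermD //; apply: contraNneq zD => <-.
apply/idP/idP => Hs; last exact: perm_onM.
have := perm_onM Ht Hs; rewrite mulgA.
by rewrite -{1}(tpermV x y) mulVg mul1g.
Qed.

(** The fixed point [m] is inserted between [i] and [s i] in the cycle of [i]: position [i] becomes
    an excedance, and [m] is not one. *)
Lemma exc_tpermM s i m : (i < m)%N -> (s i <= m)%N -> s m = m ->
  exc (tperm i m * s)%g = (exc s + ~~ (i < s i))%N.
Proof.
move=> lt_im le_sim sm.
have neq : m != i by apply: contraTneq lt_im => ->; rewrite ltnn.
rewrite !excE (bigD1 i) //= (bigD1 m) //= [in RHS](bigD1 i) //= [in RHS](bigD1 m) //=.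
rewrite !permM tpermL tpermR sm lt_im ltnn (leq_gtF le_sim) add0n addnAC.
rewrite (eq_bigr (fun j => (j < s j : nat))%N); last first.
  by move=> j /andP[ji jm]; rewrite permM tpermD // eq_sym.
by case: (i < s i)%N; rewrite add0n ?addn0 ?add0n //= addnC.
Qed.

Lemma exc_perm_on D s : perm_on D s -> exc s = (\sum_(i in D) (i < s i))%N.
Proof.
move=> Hs; rewrite excE (bigID (mem D)) /= [X in (_ + X)%N]big1 ?addn0 // => i iD.
by rewrite (out_perm Hs) // ltnn.
Qed.

(** Insert the largest point [m] of [D] into a permutation of [D :\ m] with e excedances: the
    exponent stays e when [m] is fixed or inserted at an excedance, and grows by 1 at the other
    points. This is the insertion recurrence of [eul] on the monomial t^e. *)
Lemma sum_exc_perm_on (R : comNzRingType) D :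
  \sum_(s | perm_on D s) 'X^(exc s) = eul R #|D|.
Proof.
elim: {D}_.+1 {-2}D (ltnSn #|D|) => // k IHk D.
have [->|[i0 i0D]] := set_0Vmem D.
  move=> _; rewrite cards0 (big_pred1 1%g) => [|s].
    by rewrite excE big1 // => i _; rewrite perm1 ltnn.
  rewrite inE; apply/idP/eqP => [Hs|->]; last exact: perm_on1.
  by apply/permP => x; rewrite perm1 (out_perm Hs) // inE.
case: (arg_maxnP (fun i : 'I_n => i : nat) i0D) => m /= mD' max_m'.
have mD : m \in D by [].
have {mD' max_m'} max_m i : i \in D -> (i <= m)%N := max_m' i.
rewrite (cardsD1 m) mD add1n ltnS => lt_k.
have mE s i : perm_on (D :\ m) s -> i \in D -> (s i <= m)%N /\ s m = m.
  rewrite perm_on_setD1 // => /andP[Hs /eqP ->] iD; split=> //.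
  by apply: max_m; rewrite (perm_closed i Hs).
rewrite eulS -IHk // raddf_sum !mulr_sumr -big_split /=.
rewrite (partition_big (fun s : 'S_n => (s^-1)%g m) (mem D)) /=; last first.
  by move=> s Hs; rewrite (perm_closed _ (perm_onV Hs)).
transitivity (\sum_(i in D) \sum_(s | perm_on (D :\ m) s)
    'X^(exc (tperm i m * s)%g) : {poly R}).
  apply: eq_bigr => i iD; rewrite (reindex_inj (mulgI (tperm i m))) /=.
  apply: eq_bigl => s; rewrite perm_on_tpermM // perm_on_setD1 //; congr (_ && _).
  by rewrite -(inj_eq (@perm_inj _ (tperm i m * s))) permKV permM tpermL eq_sym.
rewrite exchange_big; apply: eq_bigr => s Hs /=.
rewrite (bigD1 m) //= tperm1 mul1g.
rewrite (eq_big (mem (D :\ m)) (fun i => 'X^(exc s + ~~ (i < s i)%N))); first last.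
- move=> i /andP[iD im]; have [le_sim sm] := mE s i Hs iD.
  by rewrite exc_tpermM // ltn_neqAle max_m // andbT.
- by move=> i; rewrite !inE andbC.
have: (\sum_(i in D :\ m) ~~ (i < s i)%N + exc s = #|D :\ m|)%N.
  rewrite (exc_perm_on Hs) -big_split /= -sum1_card.
  by apply: eq_bigr => i _; case: ltnP.
have [Hexc Hsum] : exc s = (\sum_(i in D :\ m | (i < s i)%N) 1)%N /\
    (\sum_(i in D :\ m) ~~ (i < s i)%N)%N = (\sum_(i in D :\ m | ~~ (i < s i)%N) 1)%N.
  by rewrite (exc_perm_on Hs) !big_mkcondr /=; split; apply: eq_bigr => i _; case: ltnP.
move=> <-.
have -> : \sum_(i in D :\ m) 'X^(exc s + ~~ (i < s i)%N) =
    'X^(exc s) *+ exc s + 'X^((exc s).+1) *+ (\sum_(i in D :\ m) ~~ (i < s i)%N)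
    :> {poly R}.
  rewrite (bigID (fun i => i < s i)%N) Hsum {4}Hexc !sum1_card -!sumr_const /=.
  by congr (_ + _); apply: eq_bigr => i /andP[_]; [move-> | move/negbTE->];
    rewrite ?addn0 ?addn1.
rewrite derivXn; move: (\sum_(i in _) _)%N => a.
case: (exc s) => [|e]; rewrite ?mulr0n ?mulr0 /= ?exprS; ring.
Qed.

End PermStatistics.

(** * The Eulerian polynomial at q = -1 *)

Section SignedEulerian.

Variables (R : realFieldType) (n : nat).
Implicit Types (s : 'S_n) (i j x y : 'I_n) (D J : {set 'I_n}).

(* Descents at odd 1-based positions; these determine the parity of maj. *)
Definition odd_des s : nat :=
  (\sum_(i < n | ~~ odd i) \sum_(j < n | j == i.+1 :> nat) (s j < s i)%N)%N.

Lemma signr_maj s : (-1) ^+ maj s = (-1) ^+ odd_des s :> R.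
Proof.
rewrite /maj /odd_des [in RHS]big_mkcond /= !expr_sum; apply: eq_bigr => i _.
rewrite big_mkcondr /=; case: ifP => [ev|od]; rewrite !expr_sum.
- by apply: eq_bigr => j _; case: ltnP => // _; rewrite -signr_odd /= ev.
- rewrite big1 // => j _; case: ltnP => // _; by rewrite -signr_odd /= od.
Qed.

(** The exponent of the sign has the parity of [maj s - exc s], without a truncated subtraction. *)
Definition signed_weight s : {poly R} := (-1) ^+ (odd_des s + exc s) *: 'X^(exc s).

Local Notation w := signed_weight.

(** * Swapping the entries at positions [x] even and [y = x.+1] odd, counted from 0 *)

Section Pair.

Variables x y : 'I_n.
Hypotheses (ev_x : ~~ odd x) (xy : y = x.+1 :> nat).

Let lt_xy : (x < y)%N. Proof. by rewrite xy. Qed.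
Let neq_yx : y != x. Proof. by apply: contraTneq lt_xy => ->; rewrite ltnn. Qed.

(** The pairs compared by [odd_des] are disjoint, so only the comparison between [x] and [y]
    changes, and it flips. *)
Lemma signr_odd_des_tpermM s :
  (-1) ^+ odd_des (tperm x y * s)%g = - (-1) ^+ odd_des s :> R.
Proof.
rewrite /odd_des (bigD1 x) //= [in RHS](bigD1 x) //= !exprD -mulNr; congr (_ * _).
  rewrite !(big_pred1 y) => [|j|j]; try by rewrite /= -xy.
  rewrite !permM tpermL tpermR; case: ltngtP => //; first by rewrite opprK.
  by move=> /val_inj/perm_inj E; have := neq_yx; rewrite E eqxx.
congr (_ ^+ _); apply: eq_bigr => i /andP[ev ix]; apply: eq_bigr => j /eqP ji.
rewrite !permM !tpermD //; first by rewrite eq_sym.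
- by apply: contraNneq ev => <-; rewrite xy /= ev_x.
- by apply: contraNneq ev_x => ->; rewrite ji /= ev.
- by apply: contraNneq ix => /(congr1 val) /=; rewrite xy ji => -[] /val_inj ->.
Qed.

Lemma exc_pair s : exc s = ((x < s x) + (y < s y) +
  \sum_(i < n | (i != x) && (i != y)) (i < s i))%N.
Proof. by rewrite excE (bigD1 x) //= (bigD1 y) //= addnA. Qed.

Lemma exc_pair_tpermM s : exc (tperm x y * s)%g = ((x < s y) + (y < s x) +
  \sum_(i < n | (i != x) && (i != y)) (i < s i))%N.
Proof.
rewrite exc_pair !permM tpermL tpermR; congr (_ + _)%N.
by apply: eq_bigr => i /andP[ix iy]; rewrite permM tpermD // eq_sym.
Qed.

(** Only the value [y] can be an excedance at [x] without being one at [y]. *)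
Let lt_pair i : i != y -> (x < i)%N = (y < i)%N.
Proof. by rewrite -(inj_eq val_inj) /= xy; lia. Qed.

Lemma signed_weight_tpermM_free s : s x != y -> s y != y ->
  w (tperm x y * s)%g = - w s.
Proof.
move=> sx sy; rewrite /signed_weight !exprD signr_odd_des_tpermM exc_pair_tpermM exc_pair.
by rewrite !lt_pair // [(_ + (y < s y))%N]addnC mulNr scaleNr.
Qed.

(** Moving the value [y] from position [y] to [x] creates one excedance, whose sign cancels that
    from [odd_des]. *)
Lemma signed_weight_tpermM_fix s : s y = y -> w (tperm x y * s)%g = 'X * w s.
Proof.
move=> sy; have sx : s x != y.
  by apply: contra_neq neq_yx => sx; apply: (@perm_inj _ s); rewrite sy.
have E : exc (tperm x y * s)%g = (exc s).+1.
  by rewrite exc_pair_tpermM exc_pair sy lt_xy ltnn addn0 lt_pair.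
rewrite /signed_weight !exprD signr_odd_des_tpermM E !exprS mulN1r mulrNN.
by rewrite -scalerAr.
Qed.

(** The terms are split by the place of the value [y]: at [y] they give the smaller sum, at [x] they
    give ['X] times it, and elsewhere they cancel. *)
Lemma sum_signed_weight_step D : x \in D -> y \in D ->
  \sum_(s | perm_on D s) w s = (1 + 'X) * \sum_(s | perm_on (D :\ y) s) w s.
Proof.
move=> xD yD.
rewrite (bigID (fun s : 'S_n => s y == y)) /= mulrDl mul1r; congr (_ + _).
  by apply: eq_bigl => s; rewrite perm_on_setD1.
rewrite (bigID (fun s : 'S_n => s x == y)) /= [X in _ + X](_ : _ = 0) ?addr0.
  rewrite (reindex_inj (mulgI (tperm x y))) mulr_sumr /=.
  apply: eq_big => s.
    rewrite perm_on_tpermM // !permM tpermL tpermR perm_on_setD1 // -andbA.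
    congr (_ && _); case: (s y =P y) => [sy|]; rewrite ?andbF // andbT.
    by apply: contra_neq neq_yx => sx; apply: (@perm_inj _ s); rewrite sy.
  by rewrite !permM tpermL tpermR => /andP[_ /eqP]; apply: signed_weight_tpermM_fix.
(* Swapping is a sign-reversing involution here; the sum then vanishes in characteristic zero. *)
set S := \sum_(s | _) _; have : S = - S.
  rewrite {1}/S (reindex_inj (mulgI (tperm x y))) -sumrN; apply: eq_big => s /=.
    by rewrite perm_on_tpermM // !permM tpermL tpermR -!andbA; congr (_ && _); rewrite andbC.
  rewrite !permM tpermL tpermR => /andP[/andP[_ sx] sy].
  exact: signed_weight_tpermM_free.
by move/eqP; rewrite -addr_eq0 -mulr2n -scaler_nat scaler_eq0 pnatr_eq0 => /eqP.
Qed.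

End Pair.

(** The points of [J] are fixed one at a time; the partner [y.-1] is even, so it lies outside [J]
    and stays free to be swapped. *)
Lemma sum_signed_weight_odd J : (forall y, y \in J -> odd y) ->
  \sum_s w s = (1 + 'X) ^+ #|J| * \sum_(s | perm_on (~: J) s) w s.
Proof.
elim: {J}_.+1 {-2}J (ltnSn #|J|) => // k IHk J.
have [->|[y yJ]] := set_0Vmem J.
  move=> _ _; rewrite cards0 mul1r; apply: eq_bigl => s.
  by rewrite setC0; apply/esym/subsetP => x; rewrite inE.
rewrite (cardsD1 y) yJ add1n ltnS => lt_k od.
have y0 : (0 < y)%N by have := od y yJ; case: (y : nat).
have lt_n : (y.-1 < n)%N by apply: leq_ltn_trans (leq_pred _) (ltn_ord y).
pose x := Ordinal lt_n.
have xy : y = x.+1 :> nat by rewrite /= prednK.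
have ev_x : ~~ odd x by have := od y yJ; rewrite xy.
rewrite (IHk (J :\ y)) // => [|z]; last by rewrite inE => /andP[_ /od].
rewrite (@sum_signed_weight_step x y ev_x xy); first last.
- by rewrite !inE eqxx.
- by rewrite !inE negb_and (contra (od x)) ?orbT.
rewrite mulrA -exprSr; congr (_ * _); apply: eq_bigl => s.
by congr perm_on; apply/setP => z; rewrite !inE; case: eqP => [->|]; rewrite ?yJ.
Qed.

Definition odd_points := [set y : 'I_n | odd y].

(** After an even [i] comes the fixed value [i.+1], which [s i] avoids, so a descent there is an
    excedance. Hence all remaining signs are +1. *)
Lemma odd_des_perm_on s : perm_on (~: odd_points) s -> odd_des s = exc s.
Proof.
move=> Hs; have fix_od y : odd y -> s y = y.
  by move=> od; apply: (out_perm Hs); rewrite !inE od.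
rewrite excE /odd_des [RHS](bigID (fun i : 'I_n => odd i)) /=.
rewrite [X in (X + _)%N]big1 ?add0n => [|i /fix_od ->]; last by rewrite ltnn.
apply: eq_bigr => i ev; case: (ltnP i.+1 n) => [lt_n|le_n].
  pose y := Ordinal lt_n; have sy : s y = y by apply: fix_od.
  rewrite (big_pred1 y) // sy /=.
  have : s i != y.
    by apply/eqP; rewrite -{1}sy => /perm_inj/(congr1 val) /=; lia.
  by rewrite -(inj_eq val_inj) /= => ?; congr nat_of_bool; lia.
(* For odd [n] the last position has no successor, and it is no excedance. *)
rewrite big1 => [|j /eqP ji]; last by have := ltn_ord j; rewrite ji ltnNge le_n.
by have := ltn_ord (s i); case: ltnP => //; lia.
Qed.

Lemma card_odd_points : #|odd_points| = n./2.
Proof.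
have -> : #|odd_points| = (\sum_(i < n) odd i)%N.
  rewrite -sum1_card big_mkcond; apply: eq_bigr => i _.
  by rewrite inE; case: odd.
elim: n => [|k IH]; first by rewrite big_ord0.
by rewrite big_ord_recr /= IH uphalf_half addnC.
Qed.

Lemma sum_signed_weight :
  \sum_s w s = (1 + 'X) ^+ n./2 * eul R (uphalf n).
Proof.
rewrite (@sum_signed_weight_odd odd_points) => [|y]; last by rewrite inE.
rewrite card_odd_points; congr (_ * _).
have <- : #|~: odd_points| = uphalf n.
  have := cardsC odd_points; rewrite card_ord card_odd_points uphalf_half; lia.
rewrite -sum_exc_perm_on; apply: eq_bigr => s /odd_des_perm_on od.
by rewrite /signed_weight od addnn -signr_odd odd_double scale1r.
Qed.

Lemma Eulerian_eval_neg1 :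
  map_poly (horner_eval (-1)) (Eulerian R n) = (1 + 'X) ^+ n./2 * eul R (uphalf n).
Proof.
rewrite -sum_signed_weight /Eulerian rmorph_sum; apply: eq_bigr => s _ /=.
rewrite map_polyZ map_polyXn /= /horner_eval hornerXn /signed_weight; congr (_ *: _).
rewrite exprD -signr_maj -exprD -{2}(subnK (exc_le_maj s)) -addnA addnn.
by rewrite exprD -[X in _ * X]signr_odd odd_double mulr1.
Qed.

End SignedEulerian.

(** * Positive recurrences for the signed binomial-Eulerian polynomials *)

Section SignedBinomialEulerian.

Variable R : realFieldType.

Local Notation B := (signedBinomialEulerian R).
Local Notation one := (fun=> 1 : {poly R}).
(** [e k] and [o k] are A_n(t, -1) for n = 2k and n = 2k + 1; E and O denote their exponential
    generating functions. *)
Local Notation e := (fun k : nat => (1 + 'X) ^+ k * eul R k).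
Local Notation o := (fun k : nat => (1 + 'X) ^+ k * eul R k.+1).

Lemma bconv_geometric c (f g : nat -> {poly R}) n :
  bconv (fun k => c ^+ k * f k) (fun k => c ^+ k * g k) n = c ^+ n * bconv f g n.
Proof.
rewrite /bconv mulr_sumr; apply: eq_bigr => i _.
by rewrite mulrACA -exprD subnKC ?mulrnAr // -ltnS.
Qed.

(** The quadratic recurrence of [eul], rescaled by (1 + t)^k: O = E (1 - t + t E). *)
Lemma o_quadratic k : o k = (1 - 'X) * e k + 'X * bconv e e k.
Proof. by rewrite bconv_geometric eul_quadratic mulrDr; congr (_ + _); rewrite mulrCA. Qed.

Lemma sum_even_odd (F : nat -> {poly R}) k :
  \sum_(m < k.*2) F m = \sum_(j < k) (F j.*2 + F j.*2.+1).
Proof.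
elim: k => [|k IH]; first by rewrite !big_ord0.
by rewrite doubleS !big_ord_recr /= IH addrA.
Qed.

Definition signed_term n m : {poly R} := if odd m && ~~ odd n then 0
  else (1 + 'X) ^+ m./2 * eul R (uphalf m) *+ 'C(n./2, m./2).

(** Including the term m = 0, which equals 1, turns the constant 1 into 1 - t. *)
Lemma signedBinomialEulerianE n :
  B n = (1 - 'X) + 'X * \sum_(m < n.+1) signed_term n m.
Proof.
rewrite /signedBinomialEulerian /binomialEulerian rmorphD rmorph1 rmorphM /= map_polyX.
rewrite rmorph_sum /= big_add1 /= big_mkord big_ord_recl.
rewrite /signed_term /= bin0 mulr1n !mul1r.
rewrite mulrDr mulr1 addrA subrK; congr (_ + _ * _); apply: eq_bigr => i _.
rewrite map_polyZ /= Eulerian_eval_neg1 /horner_eval qbinomial_eval_neg1 //.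
by case: ifP => _; rewrite ?scale0r ?scaler_nat.
Qed.

(** For even n the terms with odd m vanish. In generating functions, T = e^z (1 - t + t E). *)
Lemma signedBinomialEulerian_even k :
  B k.*2 = (1 - 'X) + 'X * bconv one e k.
Proof.
rewrite signedBinomialEulerianE; congr (_ + _ * _).
rewrite big_ord_recr sum_even_odd bconvC [RHS]big_ord_recr /signed_term /=.
rewrite !odd_double /= doubleK uphalf_double mulr1; congr (_ + _).
apply: eq_bigr => j _.
by rewrite !odd_double /= doubleK uphalf_double addr0 mulr1.
Qed.

Lemma signedBinomialEulerian_odd k :
  B k.*2.+1 = B k.*2 + 'X * bconv one o k.
Proof.
rewrite signedBinomialEulerian_even signedBinomialEulerianE -[RHS]addrA -mulrDr.
rewrite -bconvDr bconvC -doubleS sum_even_odd; congr (_ + _ * _).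
apply: eq_bigr => j _; rewrite /signed_term /= !odd_double /=.
by rewrite !uphalf_double !doubleK mulr1 mulrnDl.
Qed.

(* T' = T (1 + t (1 + t) E) for the exponential generating functions T of the
   even-indexed B and E of e. *)
Lemma signedBinomialEulerian_evenS k : B k.+1.*2 =
  B k.*2 + 'X * (1 + 'X) * bconv e (fun i => B i.*2) k.
Proof.
(* This is E' = (1 + t) E (1 - t + t E), whose last factor becomes T after multiplication by e^z. *)
have eS j : e j.+1 = (1 + 'X) * ((1 - 'X) * e j + 'X * bconv e e j).
  by rewrite -o_quadratic exprS mulrA.
rewrite [in RHS](eq_bconv _ (fun=> erefl) signedBinomialEulerian_even).
rewrite !signedBinomialEulerian_even bconvS (eq_bconv _ (fun=> erefl) eS).
rewrite bconvZr (bconvDr one (fun j => (1 - 'X) * e j)) (bconvDr e (fun=> 1 - 'X)).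
rewrite !bconvZr bconv_const.
have -> : bconv e (bconv one e) k = bconv one (bconv e e) k.
  by rewrite !bconvA; apply: eq_bconv => // i; apply: bconvC.
move: (bconv one e k) (bconv one (bconv e e) k) => a b; ring.
Qed.

(** Here e^z O = e^z E (1 - t + t E) = E T. *)
Lemma signedBinomialEulerian_oddE k :
  B k.*2.+1 = B k.*2 + 'X * bconv e (fun i => B i.*2) k.
Proof.
rewrite signedBinomialEulerian_odd; congr (_ + _ * _).
rewrite [in RHS](eq_bconv _ (fun=> erefl) signedBinomialEulerian_even).
rewrite (eq_bconv _ (fun=> erefl) o_quadratic).
rewrite (bconvDr one (fun j => (1 - 'X) * e j)) (bconvDr e (fun=> 1 - 'X)).
rewrite !bconvZr bconv_const; congr (_ + _ * _).
by rewrite !bconvA; apply: eq_bconv => // i; apply: bconvC.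
Qed.

Lemma symcone_eul k : symcone k (eul R k.+1).
Proof.
elim/ltn_ind: k => -[_|k IH].
  by rewrite eulS eul0 mulr0n derivC mulr0 addr0 addr0 mulr1; apply: symcone1.
rewrite eul_quadratic bconv_recr big_ord_recl /= eul0 mulr1 bin0 mul1r mulr1n.
set S := \sum_(i < _) _.
(* The two end terms contain [eul 0 = 1], which breaks the pattern of centres; merged with the
   negative term they give the factor 1 + t. *)
have -> : (1 - 'X) * eul R k.+1 + 'X * (eul R k.+1 + (eul R k.+1 + S)) =
    (1 + 'X) * eul R k.+1 + 'X * S by ring.
apply: symconeD; first by apply: (symconeM (symcone_1DX R) (IH k (ltnSn k))).
rewrite mulr_sumr; apply: symcone_sum => i _.
have -> : (k.+1 - lift ord0 i = (k - i.+1).+1)%N.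
  by rewrite lift0; have := ltn_ord i; lia.
rewrite mulrnAr; apply: symconeMn.
have -> : (k.+1 = 2 + (i + (k - i.+1)))%N by have := ltn_ord i; lia.
apply: (symconeM (symcone_X R)); apply: symconeM; apply: IH; have := ltn_ord i; lia.
Qed.

(** The index starts at 1 because [e 0 = 1] does not fit this centre; its term in each convolution
    is split off below. *)
Lemma symcone_e k : symcone (k + k.+1) (e k.+1).
Proof. by rewrite addnC; apply: symconeM (symcone_1DX_exp R _) (symcone_eul k). Qed.

Lemma symcone_signedBinomialEulerian_even k : symcone k.*2 (B k.*2).
Proof.
elim/ltn_ind: k => -[_|k IH].
  rewrite signedBinomialEulerian_even /bconv big_ord1 !mulr1 subrK.
  exact: symcone1.
rewrite signedBinomialEulerian_evenS /bconv big_ord_recl bin0 subn0 mulr1n !mul1r.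
set S := \sum_(i < _) _.
have -> : B k.*2 + 'X * (1 + 'X) * (B k.*2 + S) =
    (1 + 'X + 'X^2) * B k.*2 + 'X * (1 + 'X) * S.
  by move: (B _) => b; ring.
apply: symconeD; first by apply: (symconeM (symcone_1DXDX2 R) (IH k (ltnSn k))).
rewrite mulr_sumr; apply: symcone_sum => i _; rewrite lift0 mulrnAr.
apply: symconeMn.
(* Twice the centres of t, 1 + t, [e i.+1] and the earlier even-indexed polynomial. *)
have -> : (k.+1.*2 = 2 + 1 + (i + i.+1 + (k - i.+1).*2))%N by have := ltn_ord i; lia.
apply: symconeM; first exact: symconeM (symcone_X R) (symcone_1DX R).
by apply: symconeM (symcone_e i) (IH _ _); lia.
Qed.

Lemma symcone_signedBinomialEulerian n : symcone n (B n).
Proof.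
rewrite -(odd_double_half n); case: odd; last exact: symcone_signedBinomialEulerian_even.
move: n./2 => k; rewrite add1n signedBinomialEulerian_oddE.
rewrite /bconv big_ord_recl bin0 subn0 mulr1n !mul1r mulrDr addrA.
have -> : B k.*2 + 'X * B k.*2 = (1 + 'X) * B k.*2 by rewrite mulrDl mul1r.
apply: symconeD.
  by apply: (symconeM (symcone_1DX R) (symcone_signedBinomialEulerian_even k)).
rewrite mulr_sumr; apply: symcone_sum => i _; rewrite lift0 mulrnAr.
apply: symconeMn.
have -> : (k.*2.+1 = 2 + (i + i.+1 + (k - i.+1).*2))%N by have := ltn_ord i; lia.
apply: (symconeM (symcone_X R)).
exact: symconeM (symcone_e i) (symcone_signedBinomialEulerian_even _).
Qed.

End SignedBinomialEulerian.

Theorem theorem1p3 (R : realFieldType) (n : nat) (hn : (1 <= n)%N) :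
  palindromic n (signedBinomialEulerian R n) /\
  unimodal n (signedBinomialEulerian R n).
Proof.
have cone_n := symcone_signedBinomialEulerian R n.
by split; [apply: symcone_palindromic | apply: symcone_unimodal].
Qed.
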